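(* Let $\Omega=\{\omega_1,\dots,\omega_n\}$ be a finite set of states and let $\mathcal{D}=\{(p^i,x^i)\}_{i=1}^k$ be a finite dataset with $p^i,x^i\in\mathbb{R}^n_+$ and $p^i\gg\mathbf{0}$ for all $i\le k$. Suppose that $\mathcal{D}$ is SEU-rationalizable by a strictly concave, strictly increasing utility index $v:\mathbb{R}\to\mathbb{R}$ and a full-support probability measure $\pi$ on $\Omega$, and that each $x^i$ is a non-diversified demand. Then, for every scalable family $\mathcal{U}$ of concave and continuous functions from $\mathbb{R}_+$ to $\mathbb{R}$, there is $u\in\mathcal{U}$ such that $u$ is an SEU rationalization of $\mathcal{D}$ under $\pi$.
   Context: Vectors in $\mathbb{R}^n$ are indexed by states $\omega\in\Omega$; $p^i$ is a price vector and $x^i$ the demand at those prices. $x\gg y$ means $x_\omega>y_\omega$ for all $\omega\in\Omega$. The measure $\pi$ has full support if $\pi(\omega)>0$ for all $\omega\in\Omega$. Non-diversified demand: $x^i$ is a non-diversified demand if there is $\omega\in\Omega$ with $x^i_\omega>0$ and $x^i_{\omega'}=0$ for all $\omega'\neq\omega$. SEU rationalization: a real-valued function $u$ defined on (at least) $\mathbb{R}_+$ is an SEU rationalization of $\mathcal{D}$ under $\pi$ (equivalently, $\mathcal{D}$ is SEU-rationalizable by $u$ and $\pi$) if for every $i\le k$, $$\sum_{\omega\in\Omega}\pi(\omega)u(x^i_\omega)\ \ge\ \sum_{\omega\in\Omega}\pi(\omega)u(x_\omega)\quad\text{for all }x\in\mathbb{R}^n_+\text{ with }p^i\cdot x\le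 p^i\cdot x^i.$$ Supergradient: for $u:\mathbb{R}_+\to\mathbb{R}$, a supergradient of $u$ at $\overline{x}\in\mathbb{R}_+$ is a real number $y$ with $u(x)\le u(\overline{x})+y(x-\overline{x})$ for all $x\in\mathbb{R}_+$. Scalable (concave case): a collection $\mathcal{U}$ of concave and continuous functions from $\mathbb{R}_+$ to $\mathbb{R}$ is scalable if (1) there is $u\in\mathcal{U}$ which has a supergradient at $0$ and all of whose supergradients at $0$ are strictly positive; and (2) for all $\kappa\in(0,1]$ and all $v\in\mathcal{U}$, the function $v_\kappa$ defined by $v_\kappa(x):=v(\kappa x)$ for $x\in\mathbb{R}_+$ belongs to $\mathcal{U}$. Members of $\mathcal{U}$ are not required to be globally increasing. *)

(* Defs.v *)
From mathcomp Require Import all_boot all_order all_algebra.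
From mathcomp Require Import all_classical all_reals all_analysis.
Import Order.TTheory GRing.Theory Num.Theory.
Import numFieldNormedType.Exports.

Set Implicit Arguments.
Unset Strict Implicit.
Unset Printing Implicit Defensive.

Local Open Scope classical_set_scope.
Local Open Scope ring_scope.

(* The state space is 'I_n, and vectors of R^n are row vectors. A function
   defined on R_+ is encoded as a total function R -> R of which only the
   values on [nonnegR R] are ever used. *)

Definition nonnegR (R : realType) : set R := `[0, +oo[.
Arguments nonnegR : clear implicits.

Definition nonneg_vec (R : realType) (n : nat) (x : 'rV[R]_n) : Prop :=
  forall w, 0 <= x 0 w.

Definition vec_gg (R : realType) (n : nat) (x y : 'rV[R]_n) : Prop :=
  forall w, y 0 w < x 0 w.

Definition dotv (R : realType) (n : nat) (p x : 'rV[R]_n) : R :=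
  \sum_w p 0 w * x 0 w.

Definition probability_on (R : realType) (n : nat) (pi : 'I_n -> R) : Prop :=
  (forall w, 0 <= pi w) /\ \sum_w pi w = 1.

Definition full_support (R : realType) (n : nat) (pi : 'I_n -> R) : Prop :=
  forall w, 0 < pi w.

Definition non_diversified (R : realType) (n : nat) (x : 'rV[R]_n) : Prop :=
  exists w, 0 < x 0 w /\ forall w', w' != w -> x 0 w' = 0.

Definition SEU_rationalization (R : realType) (n k : nat)
    (p x : 'I_k -> 'rV[R]_n) (pi : 'I_n -> R) (u : R -> R) : Prop :=
  forall (i : 'I_k) (y : 'rV[R]_n),
    nonneg_vec y -> dotv (p i) y <= dotv (p i) (x i) ->
    \sum_w pi w * u (y 0 w) <= \sum_w pi w * u (x i 0 w).

Definition concave_on (R : realType) (D : set R) (u : R -> R) : Prop :=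
  forall t x y : R, D x -> D y -> 0 <= t -> t <= 1 ->
    t * u x + (1 - t) * u y <= u (t * x + (1 - t) * y).

Definition strictly_concave_on (R : realType) (D : set R) (u : R -> R) : Prop :=
  forall t x y : R, D x -> D y -> x != y -> 0 < t -> t < 1 ->
    t * u x + (1 - t) * u y < u (t * x + (1 - t) * y).

Definition supergradient (R : realType) (u : R -> R) (x0 y : R) : Prop :=
  forall x, nonnegR R x -> u x <= u x0 + y * (x - x0).

(* In the last clause, membership of x |-> v (kappa x) is up to equality on
   R_+, the values outside R_+ being irrelevant. *)
Definition scalable_family (R : realType) (U : set (R -> R)) : Prop :=
  (exists u, [/\ U u, exists y, supergradient u 0 y &
                 forall y, supergradient u 0 y -> 0 < y]) /\
  (forall (kappa : R) (v : R -> R), 0 < kappa -> kappa <= 1 -> U v ->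
     exists w, U w /\ forall x, nonnegR R x -> w x = v (kappa * x)).

(* Main.v *)
(* A non-diversified bundle demanded by a strictly concave agent has strictly
   the largest ratio of probability to price in the state it pays in, so the
   Kuhn-Tucker inequalities at that bundle hold with some slack.  They keep
   holding for any concave index whose supergradient at the demanded quantity
   is close enough to its supergradient at 0.  For an index with positive
   slope at 0, scaling the argument by a small kappa > 0 moves the finitely
   many demanded quantities towards 0, where the slopes approach the slope
   at 0. *)

Require Import Defs.
From mathcomp Require Import all_boot all_order all_algebra.
From mathcomp Require Import ring lra.
From mathcomp Require Import all_classical all_reals all_analysis.
Import Order.TTheory GRing.Theory Num.Theory.
Import numFieldNormedType.Exports.

Local Open Scope classical_set_scope.
Local Open Scope ring_scope.

Lemma nonnegRE {R : realType} (x : R) : nonnegR R x = (0 <= x) :> Prop.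
Proof. by rewrite /nonnegR /= in_itv /= andbT. Qed.

Lemma concave_slope {R : realType} (u : R -> R) (a b c : R) :
  concave_on (nonnegR R) u -> 0 <= a -> a < b -> b < c ->
  (u c - u b) * (b - a) <= (u b - u a) * (c - b).
Proof.
move=> cu a0 ab bc; have ca : 0 < c - a by lra.
pose t := (c - b) / (c - a).
have t0 : 0 <= t by rewrite divr_ge0 //; lra.
have t1 : t <= 1 by rewrite ler_pdivrMr //; lra.
have := cu t a c; rewrite !nonnegRE => /(_ a0 ltac:(lra) t0 t1).
have -> : t * a + (1 - t) * c = b by rewrite /t; field; rewrite gt_eqF.
have -> : t * u a + (1 - t) * u c =
    ((c - b) * u a + (b - a) * u c) / (c - a).
  by rewrite /t; field; rewrite gt_eqF.
by rewrite ler_pdivrMr // => ?; lra.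
Qed.

(** For concave [u] and [a >= 0], the supremum of this set, when finite, is the right derivative at
    [a], the least supergradient there. *)
Definition right_slopes {R : realType} (u : R -> R) (a : R) : set R :=
  [set (u y - u a) / (y - a) | y in [set y | a < y]].

Lemma right_slopes_nonempty {R : realType} (u : R -> R) (a : R) :
  right_slopes u a !=set0.
Proof. by exists ((u (a + 1) - u a) / (a + 1 - a)), (a + 1) => //=; lra. Qed.

Lemma right_slopes_ubound {R : realType} (u : R -> R) (a g : R) :
  0 <= a -> supergradient u a g -> ubound (right_slopes u a) g.
Proof.
move=> a0 ug _ [y /= ay <-]; rewrite ler_pdivrMr ?subr_gt0 //.
by have := ug y; rewrite nonnegRE => /(_ ltac:(lra)); lra.
Qed.

(** To the right of [a] the supremum dominates each chord slope by definition; to the left,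
    concavity makes each chord slope an upper bound of all right slopes, hence of their supremum. *)
Lemma sup_slope_supergradient {R : realType} (u : R -> R) (a : R) :
  concave_on (nonnegR R) u -> 0 <= a -> has_ubound (right_slopes u a) ->
  supergradient u a (sup (right_slopes u a)).
Proof.
move=> cu a0 ub y; rewrite nonnegRE => y0.
have [ya|ay|->] := ltgtP y a; last by rewrite subrr mulr0 addr0.
- suff : sup (right_slopes u a) <= (u a - u y) / (a - y).
    by rewrite ler_pdivlMr ?subr_gt0 //; lra.
  apply: ge_sup; first exact: right_slopes_nonempty.
  move=> _ [z /= az <-].
  rewrite ler_pdivrMr ?subr_gt0 // mulrAC ler_pdivlMr ?subr_gt0 //.
  exact: concave_slope.
- have : (u y - u a) / (y - a) <= sup (right_slopes u a).
    by apply: ub_le_sup => //; exists y.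
  by rewrite ler_pdivrMr ?subr_gt0 //; lra.
Qed.

(** The chord from 0 to [a] bounds the right slopes at [a]. *)
Lemma supergradient_exists {R : realType} (u : R -> R) (a : R) :
  concave_on (nonnegR R) u -> 0 < a -> exists g, supergradient u a g.
Proof.
move=> cu a0; exists (sup (right_slopes u a)).
apply: sup_slope_supergradient => //; first exact: ltW.
exists ((u a - u 0) / a) => _ [z /= az <-].
rewrite ler_pdivrMr ?subr_gt0 // mulrAC ler_pdivlMr //.
by have := concave_slope u 0 a z cu (lexx 0) a0 az; rewrite subr0.
Qed.

Lemma supergradient_gt_near0 {R : realType} {u : R -> R} {s C : R} :
  supergradient u 0 s -> s = sup (right_slopes u 0) -> C < s ->
  exists2 e, 0 < e & forall a g, 0 < a -> a < e -> supergradient u a g -> C < g.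
Proof.
move=> us sE Cs.
have ub : has_ubound (right_slopes u 0).
  by exists s; exact: right_slopes_ubound.
have [_ [h /= h0 <-]] : exists2 e, right_slopes u 0 e & C < e.
  have := sup_adherent (eps := s - C) ltac:(lra)
    (conj (right_slopes_nonempty u 0) ub).
  by rewrite -sE => -[e ? ?]; exists e => //; lra.
rewrite subr0 ltr_pdivlMr // => Ch.
have sC : 0 < s - C by lra.
(* For [a < h], [g] is at least the slope from [a] to [h], and [u a <= u 0 + s * a]. The bound on
   [a] is the point where [u h - u 0 - s * a = C * (h - a)]. *)
have d0 : 0 < (u h - u 0 - C * h) / (s - C) by rewrite divr_gt0 //; lra.
exists ((u h - u 0 - C * h) / (s - C)) => // a g a0 + ug.
rewrite ltr_pdivlMr // => aC.
have uh := us h; rewrite nonnegRE in uh; have {}uh := uh (ltW h0).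
have ua := us a; rewrite nonnegRE in ua; have {}ua := ua (ltW a0).
have gh := ug h; rewrite nonnegRE in gh; have {}gh := gh (ltW h0).
have ah : 0 < h - a.
  by rewrite subr_gt0 -(ltr_pM2r sC); lra.
by rewrite -(ltr_pM2r ah); lra.
Qed.

Lemma supergradient_scale {R : realType} (u w : R -> R) (k a g : R) :
  0 < k -> 0 <= a -> (forall x, nonnegR R x -> w x = u (k * x)) ->
  supergradient u (k * a) g -> supergradient w a (k * g).
Proof.
move=> k0 a0 wE ug x; rewrite nonnegRE => x0; rewrite !wE ?nonnegRE //.
by have := ug (k * x); rewrite nonnegRE => /(_ (mulr_ge0 (ltW k0) x0)); lra.
Qed.

(* [lam] is the Lagrange multiplier of the budget constraint. *)
Lemma seu_KKT {R : realType} (n : nat) (p x y : 'rV[R]_n) (pi g : 'I_n -> R)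
    (u : R -> R) (lam : R) :
  (forall w, 0 <= pi w) -> 0 <= lam ->
  (forall w, supergradient u (x 0 w) (g w)) ->
  (forall w, pi w * g w = lam * p 0 w \/
             x 0 w = 0 /\ pi w * g w <= lam * p 0 w) ->
  nonneg_vec y -> dotv p y <= dotv p x ->
  \sum_w pi w * u (y 0 w) <= \sum_w pi w * u (x 0 w).
Proof.
move=> pi0 lam0 ug kkt y0 pyx.
(* Weighted supergradient inequalities: where [x] vanishes, the inequality in [kkt] suffices because
   [y] is nonnegative. The price terms then sum to at most 0 by the budget. *)
have /ler_sum : forall w, true ->
    pi w * u (y 0 w) <=
    pi w * u (x 0 w) + lam * (p 0 w * y 0 w - p 0 w * x 0 w).
  move=> w _; apply: (@le_trans _ _
    (pi w * (u (x 0 w) + g w * (y 0 w - x 0 w)))).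
    by apply: ler_wpM2l => //; apply: ug; rewrite nonnegRE.
  rewrite mulrDr lerD2l mulrA; have [->|[-> le]] := kkt w; first by lra.
  by rewrite mulr0 !subr0 mulrA ler_wpM2r.
move=> /(_ (index_enum _))/le_trans; apply.
rewrite big_split /= -mulr_sumr sumrB gerDl.
by rewrite mulr_ge0_le0 // subr_le0.
Qed.

(** Equalizing consumption in [w0] and [w] within the budget cannot help, so [pi w * (v z - v 0) <=
    pi w0 * (v m - v z)]. Strict concavity makes [v] steeper on average on [[0, z]] than on
    [[z, m]], and these lengths are in the ratio of [p 0 w0] to [p 0 w]. The common factor
    [v m - v z > 0] then cancels. *)
Lemma rationalization_state_price {R : realType} (n : nat)
    (p x : 'rV[R]_n) (pi : 'I_n -> R) (v : R -> R) (w0 w : 'I_n) :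
  vec_gg p 0 -> full_support pi -> strictly_concave_on setT v ->
  {homo v : a b / a < b} ->
  (forall y, nonneg_vec y -> dotv p y <= dotv p x ->
     \sum_w pi w * v (y 0 w) <= \sum_w pi w * v (x 0 w)) ->
  0 < x 0 w0 -> (forall w', w' != w0 -> x 0 w' = 0) -> w != w0 ->
  pi w * p 0 w0 < pi w0 * p 0 w.
Proof.
move=> p0 pi0 vc vi vr; set m := x 0 w0 => m0 x0 ww0.
have pw : 0 < p 0 w by have := p0 w; rewrite mxE.
have pw0 : 0 < p 0 w0 by have := p0 w0; rewrite mxE.
have pp : 0 < p 0 w0 + p 0 w by lra.
pose t := p 0 w0 / (p 0 w0 + p 0 w).
have t0 : 0 < t by rewrite divr_gt0.
have t1 : t < 1 by rewrite ltr_pdivrMr //; lra.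
have w0w : w0 != w by rewrite eq_sym.
(* Compare [x] with the bundle on the budget line that pays the same [z] in
   [w0] and [w]. *)
pose z := t * m; have z0 : 0 < z by rewrite mulr_gt0.
have zm : z < m by rewrite /z gtr_pMl.
have split2 (F : 'I_n -> R) : \sum_i F i =
    F w0 + (F w + \sum_(i | (i != w0) && (i != w)) F i).
  by rewrite (bigD1 w0) //= (bigD1 w).
pose y : 'rV[R]_n := \row_i (if (i == w0) || (i == w) then z else 0).
have yw0 : y 0 w0 = z by rewrite mxE eqxx.
have yw : y 0 w = z by rewrite mxE eqxx orbT.
have y0 i : (i != w0) && (i != w) -> y 0 i = 0.
  by rewrite mxE -negb_or => /negbTE ->.
have := vr y; rewrite /dotv !split2 yw0 yw (x0 w) // -/m.
have y_nonneg : nonneg_vec y by move=> i; rewrite mxE; case: ifP => // _; lra.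
move=> /(_ y_nonneg).
have E (F : 'I_n -> R -> R) : \sum_(i | (i != w0) && (i != w)) F i (y 0 i) =
    \sum_(i | (i != w0) && (i != w)) F i (x 0 i).
  by apply: eq_bigr => i iw; rewrite y0 // x0 //; case/andP: iw.
rewrite (E (fun i r => p 0 i * r)) // (E (fun i r => pi i * v r)) //.
have -> : p 0 w0 * z = p 0 w0 * m - p 0 w * z.
  by rewrite /z /t; field; rewrite gt_eqF.
move=> /(_ ltac:(lra)) H.
have vz := vc t m 0 I I ltac:(by rewrite gt_eqF) t0 t1.
rewrite mulr0 addr0 -/z in vz.
have : t * (v m - v z) < (1 - t) * (v z - v 0) by lra.
have -> : 1 - t = p 0 w / (p 0 w0 + p 0 w).
  by rewrite /t; field; rewrite gt_eqF.
rewrite /t mulrAC [ltRHS]mulrAC ltr_pM2r ?invr_gt0 // => K.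
have vzm := vi _ _ zm.
rewrite -(ltr_pM2r (x := v m - v z)) ?subr_gt0 //.
have : pi w * (p 0 w0 * (v m - v z)) < pi w * (p 0 w * (v z - v 0)).
  by rewrite ltr_pM2l.
have : p 0 w * (pi w * (v z - v 0)) <= p 0 w * (pi w0 * (v m - v z)).
  by rewrite ler_pM2l //; lra.
by lra.
Qed.

Theorem proposition1 (R : realType) (n k : nat)
    (p x : 'I_k -> 'rV[R]_n) (pi : 'I_n -> R) (v : R -> R)
    (p_nonneg : forall i, nonneg_vec (p i))
    (x_nonneg : forall i, nonneg_vec (x i))
    (p_pos : forall i, vec_gg (p i) 0)
    (pi_prob : probability_on pi) (pi_full : full_support pi)
    (v_concave : strictly_concave_on setT v)
    (v_incr : {homo v : a b / a < b})
    (v_rat : SEU_rationalization p x pi v)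
    (x_nondiv : forall i, non_diversified (x i))
    (U : set (R -> R))
    (U_concave : forall u, U u -> concave_on (nonnegR R) u)
    (U_cont : forall u, U u -> {within nonnegR R, continuous u})
    (U_scalable : scalable_family U) :
  exists u, U u /\ SEU_rationalization p x pi u.
Proof.
have [[u [Uu [g ug] u_pos]] Uscale] := U_scalable.
have cu := U_concave u Uu.
pose s := sup (right_slopes u 0).
have us : supergradient u 0 s.
  by apply: sup_slope_supergradient => //; exists g; exact: right_slopes_ubound.
have s0 := u_pos s us.
have [om om_nondiv] := choice x_nondiv.
have om_pos i : 0 < x i 0 (om i) by have [] := om_nondiv i.
have near_scaled i C : C < s ->
    \forall c \near 0^'+, forall g, supergradient u (c * x i 0 (om i)) g -> C < g.
  move=> Cs.
  have [e e0 He] := supergradient_gt_near0 us erefl Cs.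
  near=> c => h; apply: He; first by rewrite mulr_gt0.
  rewrite -ltr_pdivlMr //; near: c; apply: nbhs_right_lt.
  exact: divr_gt0.
have p0 i w : 0 < p i 0 w by have := p_pos i w; rewrite mxE.
(* Finitely many pairs of observation and state allow one common [c]. Positivity of [g] will make
   the multiplier nonnegative. *)
have near_ok : \forall c \near 0^'+, forall i w' g,
    supergradient u (c * x i 0 (om i)) g ->
    0 < g /\ (w' != om i -> s * pi w' * p i 0 (om i) < g * pi (om i) * p i 0 w').
  apply: filter_forall => i; apply: filter_forall => w'.
  have [_|ne] := eqVneq w' (om i).
    by apply: filterS (near_scaled i 0 s0) => c H h /H.
  have q0 : 0 < pi (om i) * p i 0 w' by rewrite mulr_gt0.
  (* The threshold is the slope at [om i] for which the Kuhn-Tucker inequality in state [w'], with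
     slope [s] at 0, would bind. *)
  have Cs : s * pi w' * p i 0 (om i) / (pi (om i) * p i 0 w') < s.
    rewrite ltr_pdivrMr // -mulrA ltr_pM2l //.
    have [xw x0] := om_nondiv i.
    exact: rationalization_state_price (v_rat i) xw x0 ne.
  apply: filterS2 (near_scaled i 0 s0) (near_scaled i _ Cs) => c H0 HC h uh.
  by split=> [|_]; [exact: H0|rewrite -[ltRHS]mulrA -ltr_pdivrMr //; exact: HC].
have [c [[c0 c1] Hc]] := filter_ex (filterI
  (filterI (nbhs_right_gt 0) (nbhs_right_le ltr01)) near_ok).
have [w [Uw wE]] := Uscale c u c0 c1 Uu.
exists w; split=> // i y y0 pyx.
have cx0 : 0 < c * x i 0 (om i) by rewrite mulr_gt0.
have [h uh] := supergradient_exists _ _ cu cx0.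
have [h0 _] := Hc i (om i) h uh.
have [_ x0] := om_nondiv i.
(* Rescaling the argument by [c] multiplies the supergradients [h] and [s] by [c]; the multiplier is
   chosen to give equality in state [om i]. *)
apply: (seu_KKT _ (p i) (x i) y pi (fun w' => c * (if w' == om i then h else s))
  w (c * (h * pi (om i) / p i 0 (om i)))) => //.
- by move=> w'; exact: ltW.
- by rewrite !mulr_ge0 ?invr_ge0 // ltW.
- move=> w'; apply: (supergradient_scale u) => //; first exact: x_nonneg.
  by have [->//|ne] := eqVneq w' (om i); rewrite x0 // mulr0.
- move=> w'; have [->|ne] := eqVneq w' (om i).
    by left; field; rewrite gt_eqF.
  right; split; first exact: x0.
  rewrite mulrCA -[leRHS]mulrA ler_pM2l // mulrAC ler_pdivlMr //.
  rewrite [pi w' * s]mulrC ltW //.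
  by have [_] := Hc i w' h uh; exact.
Unshelve. all: by end_near. Qed.
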